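(* Let $\{Y_z\}_{z\in\mathbb{Z}^d}$ be i.i.d. $\mathbb{R}^d$-valued random variables, and let $\Lambda$ be the point process given by $[\Lambda]:=\{z+Y_z:z\in\mathbb{Z}^d\}$. For $d=1,2$, if $\mathbb{E}\|Y_0\|^d<\infty$, then $\Lambda$ is neither insertion-tolerant nor deletion-tolerant.
   Context: Point processes are always assumed to be simple and locally finite, i.e. random elements of the space $\mathbb{M}$ of simple locally finite point measures on $\mathbb{R}^d$, equipped with the product $\sigma$-field (generated by the evaluations $\mu\mapsto\mu(A)$, $A$ Borel). The support of $\mu\in\mathbb{M}$ is $[\mu]=\{y\in\mathbb{R}^d:\mu(\{y\})=1\}$. $\|\cdot\|$ is the Euclidean norm. For random variables $X,Y$ with values in the same measurable space, $X\prec Y$ means that $\mathbb{P}(Y\in\mathcal{A})=0$ implies $\mathbb{P}(X\in\mathcal{A})=0$ for all measurable $\mathcal{A}$. For $x\in\mathbb{R}^d$, $\delta_x$ is the point measure at $x$. A point process $\Pi$ is insertion-tolerant if for every Borel set $S\subseteq\mathbb{R}^d$ with Lebesgue measure in $(0,\infty)$, if $U$ is uniformly distributed on $S$ and independent of $\Pi$, then $\Pi+\delta_U\prec\Pi$. A $\Pi$-point is an $\mathbb{R}^d$-valued random variable $Z$ with $Z\in[\Pi]$ almost surely; $\Pi$ is deletion-tolerant if $\Pi-\delta_Z\prec\Pi$ for any $\Pi$-point $Z$.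
   Formalization: The points z+Y_z are assumed almost surely pairwise distinct (the sum of the δ_{z+Y_z} is simple); if coinciding points are merged the claim fails, e.g. for d=1 and Y_0 charging every integer with finite mean, where Λ is deletion-tolerant. *)

(* Defs.v *)
From HB Require Import structures.
From mathcomp Require Import all_boot all_order all_algebra.
From mathcomp Require Import all_classical all_reals all_analysis.
From mathcomp Require Import measurable_realfun.

Set Implicit Arguments.
Unset Strict Implicit.
Unset Printing Implicit Defensive.

Import Order.TTheory GRing.Theory Num.Theory.
Import numFieldNormedType.Exports.

Local Open Scope classical_set_scope.
Local Open Scope ring_scope.

(* R^d as d-tuples: the library's sigma-algebra on tuples is the one generated
   by the coordinates, i.e. the Borel sigma-algebra. (The library's norm on
   row vectors is the sup norm, hence [enorm] below.) *)
Notation vec R d := (d.-tuple (Real.sort R)).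

Definition enorm (R : realType) (d : nat) (x : vec R d) : R :=
  Num.sqrt (\sum_(i < d) tnth x i ^+ 2).

Definition lattice_translate (R : realType) (d : nat) (z : d.-tuple int)
    (y : vec R d) : vec R d :=
  [tuple (tnth z i)%:~R + tnth y i | i < d].

Definition origin (d : nat) : d.-tuple int := [tuple 0 | _ < d].

(* Lebesgue measure on R^d, as the iterated product
   lambda_{n+1}(A) = \int lambda_n({t | (x, t) \in A}) dx, where lambda_0 is the
   unit mass on R^0. *)
Fixpoint lebesgue_vec (R : realType) (n : nat) : set (vec R n) -> \bar R :=
  match n return set (vec R n) -> \bar R with
  | 0 => fun A => \d_([tuple] : vec R 0) A
  | m.+1 => fun A => (\int[@lebesgue_measure R]_x
      @lebesgue_vec R m [set t | A (cons_tuple x t)])%E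
  end.

(* A point measure mu is represented by the set function A |-> mu A, of which
   only the values on Borel sets matter. The sigma-algebra on set functions is
   the product one, generated by the evaluations mu |-> mu A, A Borel; the
   sigma-algebra of the space of simple locally finite point measures is its
   trace. Working in the ambient space makes mu + \d_x and mu - \d_x total. *)
Definition evaluation_events (R : realType) (d : nat) :
    set (set (set (vec R d) -> \bar R)) :=
  [set E | exists A : set (vec R d), exists B : set \bar R,
    [/\ measurable A, measurable B & E = [set mu | B (mu A)]]].

Notation set_function R d := (g_sigma_algebraType (@evaluation_events R d)).

Definition locally_finite (R : realType) (d : nat) (C : set (vec R d)) : Prop :=
  forall r : R, finite_set (C `&` [set x | enorm x <= r]).

(* mu = \sum_(x in C) \d_x for some locally finite set C. *)
Definition simple_point_measure (R : realType) (d : nat)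
    (mu : set_function R d) : Prop :=
  exists C : set (vec R d), locally_finite C /\
    forall A : set (vec R d), measurable A -> mu A = counting (A `&` C).

Definition point_support (R : realType) (d : nat) (mu : set_function R d) :
    set (vec R d) :=
  [set y | mu [set y] = 1%E].

Definition point_process (R : realType) (d : nat) (disp : measure_display)
    (Omega : measurableType disp) (P : probability Omega R)
    (Pi : {RV P >-> set_function R d}) : Prop :=
  forall w, simple_point_measure (Pi w).

Definition add_point (R : realType) (d : nat) (mu : set_function R d)
    (x : vec R d) : set_function R d :=
  fun A => (mu A + \d_x A)%E.

Definition remove_point (R : realType) (d : nat) (mu : set_function R d)
    (x : vec R d) : set_function R d :=
  fun A => (mu A - \d_x A)%E.

(* X \prec Y, where X and Y may live on different probability spaces. *)
Definition prec (R : realType) (disp1 disp2 disp3 : measure_display)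
    (Omega1 : measurableType disp1) (Omega2 : measurableType disp2)
    (T : measurableType disp3) (P1 : probability Omega1 R)
    (P2 : probability Omega2 R) (X : Omega1 -> T) (Y : Omega2 -> T) : Prop :=
  forall E : set T, measurable E ->
    P2 (Y @^-1` E) = 0%E -> P1 (X @^-1` E) = 0%E.

Definition same_law (R : realType) (disp1 disp2 disp3 : measure_display)
    (Omega1 : measurableType disp1) (Omega2 : measurableType disp2)
    (T : measurableType disp3) (P1 : probability Omega1 R)
    (P2 : probability Omega2 R) (X : Omega1 -> T) (Y : Omega2 -> T) : Prop :=
  forall E : set T, measurable E -> P1 (X @^-1` E) = P2 (Y @^-1` E).

Definition independent (R : realType) (disp disp1 disp2 : measure_display)
    (Omega : measurableType disp) (T1 : measurableType disp1)
    (T2 : measurableType disp2) (P : probability Omega R)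
    (X : Omega -> T1) (Y : Omega -> T2) : Prop :=
  forall (E : set T1) (F : set T2), measurable E -> measurable F ->
    P (X @^-1` E `&` Y @^-1` F) = (P (X @^-1` E) * P (Y @^-1` F))%E.

Definition mutually_independent (R : realType) (disp disp' : measure_display)
    (Omega : measurableType disp) (T : measurableType disp')
    (P : probability Omega R) (I : choiceType) (X : I -> Omega -> T) : Prop :=
  forall (s : seq I) (E : I -> set T), uniq s ->
    (forall i, measurable (E i)) ->
    P (\bigcap_(i in [set` s]) (X i @^-1` E i)) =
      (\prod_(i <- s) P (X i @^-1` E i))%E.

Definition iid (R : realType) (disp disp' : measure_display)
    (Omega : measurableType disp) (T : measurableType disp')
    (P : probability Omega R) (I : choiceType) (X : I -> Omega -> T) : Prop :=
  mutually_independent P X /\ forall i j, same_law P P (X i) (X j).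

(* To be used only when 0 < lebesgue_vec S < +oo. *)
Definition uniform_on (R : realType) (d : nat) (disp : measure_display)
    (Omega : measurableType disp) (P : probability Omega R)
    (S : set (vec R d)) (U : Omega -> vec R d) : Prop :=
  forall A : set (vec R d), measurable A ->
    P (U @^-1` A) = ((fine (lebesgue_vec S))^-1%:E * lebesgue_vec (A `&` S))%E.

(* An independent U need not exist on the space carrying Pi, so U is taken on
   any probability space carrying a copy Pi' of Pi. *)
Definition insertion_tolerant (R : realType) (d : nat) (disp : measure_display)
    (Omega : measurableType disp) (P : probability Omega R)
    (Pi : {RV P >-> set_function R d}) : Prop :=
  forall S : set (vec R d), measurable S ->
    (0 < lebesgue_vec S)%E -> (lebesgue_vec S < +oo)%E ->
  forall (disp' : measure_display) (Omega' : measurableType disp')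
    (P' : probability Omega' R) (Pi' : {RV P' >-> set_function R d})
    (U : {RV P' >-> vec R d}),
    point_process Pi' -> same_law P' P Pi' Pi ->
    uniform_on P' S U -> independent P' U Pi' ->
    prec P' P (fun w => add_point (Pi' w) (U w)) Pi.

Definition process_point (R : realType) (d : nat) (disp : measure_display)
    (Omega : measurableType disp) (P : probability Omega R)
    (Pi : {RV P >-> set_function R d}) (Z : {RV P >-> vec R d}) : Prop :=
  {ae P, forall w, point_support (Pi w) (Z w)}.

Definition deletion_tolerant (R : realType) (d : nat) (disp : measure_display)
    (Omega : measurableType disp) (P : probability Omega R)
    (Pi : {RV P >-> set_function R d}) : Prop :=
  forall Z : {RV P >-> vec R d}, process_point Pi Z ->
    prec P P (fun w => remove_point (Pi w) (Z w)) Pi.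

(* Main.v *)
Require Import Defs.
From HB Require Import structures.
From mathcomp Require Import all_boot all_order all_algebra.
From mathcomp Require Import all_classical all_reals all_analysis.
From mathcomp Require Import measurable_realfun.
From mathcomp Require Import zify ring lra.

Import Order.TTheory GRing.Theory Num.Theory.
Import numFieldNormedType.Exports.

Local Open Scope classical_set_scope.
Local Open Scope ring_scope.

(** Adding or deleting a point is detected by a linear statistic that
fluctuates less than the change it undergoes.

Let [H_n] be the n-th harmonic sum and [f_n] the sum, over the radii r = 1..n, of
1/r times the indicator of the closed cube of centre 0 and half-side r
([log_bump]); it is a truncated and discretized logarithm. Put
[S_n mu = \int f_n dmu] ([smoothed_count]). For every point x, [f_n x / H_n]
tends to 1, so that [mu + \d_x] and [mu - \d_x] differ from [mu] in [S_n] by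
almost [H_n].

For the perturbed lattice, [S_n] is the sum over the lattice of the independent
variables [f_n (z + Y_z)]. The variance of each of them is at most its mean
squared distance to the constant [f_n z], hence the variance of [S_n] is at most
[E \sum_z (f_n (z + Y_0) - f_n z)^2]. The deterministic estimate behind the
theorem ([sum_log_bump_shift_sqr]) bounds this sum over z, in dimensions 1 and 2,
by a constant times [H_n (1 + |Y_0|^d)]. To see it, let |y| <= m. The cube of
half-side r separates z from z + y for at most O(r^(d-1) min(r, m)) lattice points
z, because one coordinate of z has to lie near a face ([count_crosses]); and the
half-sides that separate a given z from z + y lie in a window of length m
([crosses_lt]). Expanding the squares into double sums over pairs of half-sides,
the pairs whose smaller member is r contribute at most a multiple of
1/r * r^(d-1) min(r, m) * m/r, which is O(m^d / r) when d <= 2.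

Thus the standard deviation of [S_n] is O(sqrt H_n), and after centring [S_n / H_n]
tends to 0 in probability ([smoothed_count_concentration]; the infinite sum over
the lattice is cut to a finite one at the cost of an event of small probability,
[smoothed_count_exhaustion]). Along a sparse subsequence the Borel-Cantelli lemma
applies: the event E that [S_n] is infinitely often farther than [H_n / 4] from its
centring constant has probability 0 for the perturbed lattice. Any configuration
outside E falls into E once a point is added or deleted
([exists_separating_event]). Hence the modified process is almost surely in E,
and is not absolutely continuous with respect to the original one.

Insertion tolerance is refuted with the unit cube, for which an independent uniform
point is built on a product space ([independent_copy_with_uniform_point]), and
deletion tolerance with the point 0 + Y_0 of the process. *)

Set Implicit Arguments.
Unset Strict Implicit.

(** * Lattice points near the boundary of a cube *)

(** A half-open interval of natural length l contains exactly l integers,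
    wherever it is placed; this is what keeps the counts below uniform in the
    real shift. *)
Lemma int_window (R : realType) (a : R) (l : nat) :
  exists2 s : seq int, size s = l &
    forall k : int, a <= k%:~R < a + l%:R -> k \in s.
Proof.
exists [seq Num.ceil a + i%:Z | i <- iota 0 l].
  by rewrite size_map size_iota.
move=> k /andP[ak kal]; apply/mapP; exists (`|k - Num.ceil a|)%N.
  have h1 : Num.ceil a <= k by rewrite ceil_le_int.
  have h2 : k < Num.ceil a + l%:Z.
    rewrite -(ltr_int R) intrD (lt_le_trans kal)// lerD2r.
    exact: ceil_ge.
  by rewrite mem_iota /=; lia.
have h1 : Num.ceil a <= k by rewrite ceil_le_int.
by lia.
Qed.

(** Sending a tuple to the positions of its entries in the lists [S i] is
    injective on [p], with values in a product of ordinals. *)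
Lemma count_rect (d : nat) (S : 'I_d -> seq int) (p : pred (d.-tuple int))
    (F : seq (d.-tuple int)) : uniq F ->
  (forall z, p z -> forall i, tnth z i \in S i) ->
  (count p F <= \prod_i size (S i))%N.
Proof.
move=> uF pS; pose M := \max_i size (S i).
have SM i : (size (S i) <= M)%N by exact: leq_bigmax.
pose g (z : d.-tuple int) : {ffun 'I_d -> 'I_M.+1} :=
  [ffun i => inord (index (tnth z i) (S i))].
pose T : 'I_d -> pred 'I_M.+1 := fun i j => (j < size (S i))%N.
have gT z : p z -> g z \in family T.
  move=> /pS zS; apply/familyP => i.
  by rewrite ffunE unfold_in inordK ?index_mem// ltnS (leq_trans (index_size _ _)).
have ginj z w : p z -> p w -> g z = g w -> z = w.
  move=> /pS zS /pS wS /ffunP gzw; apply: eq_from_tnth => i.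
  have := congr1 (@nat_of_ord _) (gzw i); rewrite !ffunE !inordK;
    [|by rewrite ltnS (leq_trans (index_size _ _))..].
  by move=> e; rewrite -(nth_index 0 (zS i)) e nth_index.
rewrite -size_filter -(size_map g).
have <- : #|family T| = (\prod_i size (S i))%N.
  rewrite card_family foldrE big_map big_enum/=; apply: eq_bigr => i _.
  rewrite -sum1_card (eq_bigl (fun j : 'I_M.+1 => j < size (S i))%N)//.
  rewrite -(big_ord_widen _ (fun=> 1%N)) ?sum1_card ?card_ord//.
  exact: leq_trans (SM i) _.
rewrite cardE; apply: uniq_leq_size.
  rewrite map_inj_in_uniq ?filter_uniq// => z w.
  rewrite !mem_filter => /andP[pz _] /andP[pw _]; exact: ginj.
move=> h /mapP[z]; rewrite mem_filter => /andP[pz _] ->{h}.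
by rewrite mem_enum gT.
Qed.

(** This is [series harmonic n]. *)
Definition harmonic_sum (R : realType) (n : nat) : R :=
  \sum_(0 <= k < n) harmonic k.
Arguments harmonic_sum : clear implicits.

Section cubes.
Context {R : realType} {d : nat}.
Implicit Types (x y : vec R d) (z : d.-tuple int) (F : seq (d.-tuple int)).

Definition inbox (r : nat) x : bool := [forall i, `|tnth x i| <= r%:R].

Definition lattice_point z : vec R d := [tuple (tnth z i)%:~R | i < d].

Definition crosses y z (r : nat) : bool :=
  inbox r (lattice_translate z y) != inbox r (lattice_point z).

Lemma natr_odd (r : nat) : r.*2.+1%:R = r%:R + r%:R + 1 :> R.
Proof. by rewrite -addn1 -addnn !natrD. Qed.

Lemma inboxW (r s : nat) x : (r <= s)%N -> inbox r x -> inbox s x.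
Proof.
move=> rs /forallP xr; apply/forallP => i.
by rewrite (le_trans (xr i))// ler_nat.
Qed.

Lemma inbox_shift (r m : nat) y z : (forall i, `|tnth y i| <= m%:R) ->
  inbox r (lattice_translate z y) || inbox r (lattice_point z) ->
  inbox (r + m) (lattice_translate z y) && inbox (r + m) (lattice_point z).
Proof.
move=> ym /orP[] /forallP zr; apply/andP; split; apply/forallP => i;
  have := zr i; have := ym i; rewrite !tnth_mktuple natrD;
  rewrite !ler_norml => /andP[? ?] /andP[? ?]; apply/andP; split; lra.
Qed.

(** If the cube of half-side r contains one of z, z + y, then the cube of
    half-side r + m contains both, and so do all larger ones. *)
Lemma crosses_lt (r s m : nat) y z : (forall i, `|tnth y i| <= m%:R) ->
  crosses y z r -> crosses y z s -> (s < r + m)%N.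
Proof.
move=> ym cr cs; rewrite ltnNge; apply/negP => rms.
have /andP[h1 h2] : inbox s (lattice_translate z y) && inbox s (lattice_point z).
  have /andP[h1 h2] : inbox (r + m) (lattice_translate z y) &&
                      inbox (r + m) (lattice_point z).
    apply: inbox_shift => //.
    by move: cr; rewrite /crosses; do 2 case: (inbox r _).
  by rewrite (inboxW rms h1) (inboxW rms h2).
by move: cs; rewrite /crosses h1 h2.
Qed.

(** A shift by t moves k out of [-r, r] only if k lies within |t| of one end of
    the interval. The sign of t decides which end, so there are at most m such
    integers and not 2m. *)
Lemma leave_window (r m : nat) (t : R) : `|t| <= m%:R ->
  exists2 s : seq int, (size s <= minn r.*2.+1 m)%N & forall k : int,
    `|k%:~R : R| <= r%:R -> r%:R < `|k%:~R + t| -> k \in s.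
Proof.
rewrite ler_norml => /andP[tm tm'].
have [rm|mr] := leqP r.*2.+1 m.
  have [s sE sP] := int_window (- r%:R : R) r.*2.+1.
  exists s => [|k]; first by rewrite sE; lia.
  rewrite ler_norml => /andP[k1 k2] _; apply: sP.
  rewrite k1 natr_odd andTb. lra.
have [t0|t0] := leP 0 t.
- have [s sE sP] := int_window (r%:R - m%:R + 1 : R) m.
  exists s => [|k]; first by rewrite sE; lia.
  rewrite ler_norml => /andP[k1 k2] k3; apply: sP.
  have k4 : r%:Z - m%:Z < k.
    rewrite -(ltr_int R) intrB -!pmulrn.
    by move: k3; rewrite lter_normr => /orP[]; lra.
  have : r%:Z - m%:Z + 1 <= k by lia.
  by rewrite -(ler_int R) intrD intrB -!pmulrn => ->/=; lra.
- have [s sE sP] := int_window (- r%:R : R) m.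
  exists s => [|k]; first by rewrite sE; lia.
  rewrite ler_norml => /andP[k1 k2] k3; apply: sP.
  by rewrite k1/=; move: k3; rewrite lter_normr => /orP[]; lra.
Qed.

Lemma enter_window (r m : nat) (t : R) : `|t| <= m%:R ->
  exists2 s : seq int, (size s <= minn r.*2.+1 m)%N & forall k : int,
    r%:R < `|k%:~R : R| -> `|k%:~R + t| <= r%:R -> k \in s.
Proof.
rewrite ler_norml => /andP[tm tm'].
have [rm|mr] := leqP r.*2.+1 m.
  have [s sE sP] := int_window (- r%:R - t : R) r.*2.+1.
  exists s => [|k]; first by rewrite sE; lia.
  move=> _; rewrite ler_norml => /andP[k1 k2]; apply: sP.
  by apply/andP; split; rewrite ?natr_odd; lra.
have [t0|t0] := leP 0 t.
- have [s sE sP] := int_window (- r%:R - m%:R : R) m.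
  exists s => [|k]; first by rewrite sE; lia.
  move=> k3; rewrite ler_norml => /andP[k1 k2]; apply: sP.
  by apply/andP; move: k3; rewrite lter_normr => /orP[]; lra.
- have [s sE sP] := int_window (r%:R + 1 : R) m.
  exists s => [|k]; first by rewrite sE; lia.
  move=> k3; rewrite ler_norml => /andP[k1 k2]; apply: sP.
  have k4 : r%:Z < k.
    rewrite -(ltr_int R) -!pmulrn.
    by move: k3; rewrite lter_normr => /orP[]; lra.
  have : r%:Z + 1 <= k by lia.
  by rewrite -(ler_int R) intrD -!pmulrn => ->/=; lra.
Qed.

(** If the cube separates z from z + y, then some coordinate leaves or enters
    [-r, r] under the shift, which leaves min(2r+1, m) choices for it, while all
    the other coordinates of z, or all those of z + y, lie in [-r, r]. *)
Lemma count_crosses (r m : nat) y F : uniq F -> (forall i, `|tnth y i| <= m%:R) ->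
  (count (crosses y ^~ r) F <= d * (minn r.*2.+1 m * r.*2.+1 ^ d.-1).*2)%N.
Proof.
move=> uF ym.
pose a i z := [forall j, `|(tnth z j)%:~R : R| <= r%:R] &&
              (r%:R < `|(tnth z i)%:~R + tnth y i|).
pose b i z := [forall j, `|(tnth z j)%:~R + tnth y j| <= r%:R] &&
              (r%:R < `|(tnth z i)%:~R : R|).
(* a i: z is in the cube and coordinate i leaves it; b i: z + y is in the cube
   and coordinate i has entered it *)
have crossE z : (crosses y z r <= \sum_i (a i z + b i z))%N.
  case E: (crosses y z r) => //; rewrite lt0n sum_nat_eq0 negb_forall.
  have e1 : inbox r (lattice_point z) = [forall j, `|(tnth z j)%:~R : R| <= r%:R].
    by apply: eq_forallb => j; rewrite tnth_mktuple.
  have e2 : inbox r (lattice_translate z y) =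
      [forall j, `|(tnth z j)%:~R + tnth y j| <= r%:R].
    by apply: eq_forallb => j; rewrite tnth_mktuple.
  move: E; rewrite /crosses e1 e2 => E.
  apply/existsP; rewrite /a /b.
  case: forallP E => [yr|/forallP]; case: forallP => [zr|/forallP] //= + _.
  - rewrite negb_forall => /existsP[i]; rewrite -ltNge => ri.
    by exists i; rewrite ri; lia.
  - rewrite negb_forall => /existsP[i]; rewrite -ltNge => ri.
    by exists i; rewrite ri; lia.
have rect i (p : pred (d.-tuple int)) (S : 'I_d -> seq int) :
    (forall z, p z -> forall j, tnth z j \in S j) ->
    (size (S i) <= minn r.*2.+1 m)%N -> (forall j, size (S j) <= r.*2.+1)%N ->
    (count p F <= minn r.*2.+1 m * r.*2.+1 ^ d.-1)%N.
  move=> pS Si Sj; apply: (leq_trans (count_rect uF pS)).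
  rewrite (bigD1 i)//= leq_mul//.
  apply: (@leq_trans (\prod_(j < d | j != i) r.*2.+1)); first exact: leq_prod.
  rewrite prod_nat_const; apply: eq_leq; congr (_ ^ _)%N.
  by rewrite cardC1 card_ord.
have ra i : (count (a i) F <= minn r.*2.+1 m * r.*2.+1 ^ d.-1)%N.
  have [s sm sP] := leave_window r (ym i).
  have [s' s'm s'P] := int_window (- r%:R : R) r.*2.+1.
  apply: (@rect i _ (fun j => if j == i then s else s')).
  - move=> z /andP[/forallP zr zi] j; case: eqP => [->|_]; first exact: sP.
    apply: s'P; have := zr j; rewrite ler_norml => /andP[-> ?].
    by rewrite natr_odd andTb; lra.
  - by rewrite eqxx.
  - by move=> j; case: eqP => [_|_]; rewrite ?s'm// (leq_trans sm)// geq_minl.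
have rb i : (count (b i) F <= minn r.*2.+1 m * r.*2.+1 ^ d.-1)%N.
  have [s sm sP] := enter_window r (ym i).
  have s'P j := int_window (- r%:R - tnth y j) r.*2.+1.
  have {}s'P j : exists s : seq int, size s = r.*2.+1 /\
     forall k : int, `|k%:~R + tnth y j| <= r%:R -> k \in s.
    have [s' s'm s'P'] := s'P j; exists s'; split=> // k.
    rewrite ler_norml => /andP[k1 k2]; apply: s'P'.
    by apply/andP; split; rewrite ?natr_odd; lra.
  have {s'P}[s' s'P] := choice s'P.
  apply: (@rect i _ (fun j => if j == i then s else s' j)).
  - move=> z /andP[/forallP zr zi] j; case: eqP => [->|_]; first exact: sP.
    by apply: (s'P j).2.
  - by rewrite eqxx.
  - by move=> j; case: eqP => [_|_]; rewrite ?(s'P j).1// (leq_trans sm)// geq_minl.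
rewrite -sum1_count big_mkcond/=.
apply: (@leq_trans (\sum_(z <- F) \sum_i (a i z + b i z))).
  by apply: leq_sum => z _; have := crossE z; case: crosses.
rewrite exchange_big/=.
apply: (@leq_trans (\sum_(i < d) (minn r.*2.+1 m * r.*2.+1 ^ d.-1).*2)).
  apply: leq_sum => i _; rewrite big_split/= -addnn.
  rewrite -[X in (X + _)%N]big_mkcond -[X in (_ + X)%N]big_mkcond/=.
  by rewrite !sum1_count leq_add.
by rewrite sum_nat_const card_ord.
Qed.

(** * The truncated logarithm under a shift of the lattice *)

(** Each product of two distinct terms of the expanded square occurs twice, and
    is listed on the right under its smaller index. *)
Lemma sqr_sum_le (a : nat -> R) (n : nat) : (forall k, 0 <= a k) ->
  (\sum_(0 <= k < n) a k) ^+ 2 <=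
  2 * \sum_(0 <= k < n) a k * \sum_(k <= s < n) a s.
Proof.
move=> a0; elim: n => [|n IH]; first by rewrite !big_nil; lra.
rewrite !big_nat_recr//= (@big_geq _ _ _ n n)// add0r.
under [in leRHS]eq_big_nat => k /andP[_ kn].
  rewrite big_nat_recr//=; last exact: ltnW.
  rewrite mulrDr; over.
rewrite big_split/= -mulr_suml.
have := a0 n; have := sqr_ge0 (a n).
move: IH; set S := \sum_(0 <= k < n) a k; set T := \sum_(0 <= k < n) _.
rewrite !expr2; nra.
Qed.

(** On the sphere of sup-norm |x| this is about log n - log |x|. Index k stands
    for the half-side k + 1. *)
Definition log_bump (n : nat) x : R :=
  \sum_(0 <= k < n) harmonic k * (inbox k.+1 x)%:R.

Lemma harmonic_sum_ge0 n : 0 <= harmonic_sum R n.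
Proof. by apply: sumr_ge0 => k _; rewrite /harmonic/= invr_ge0. Qed.

Lemma le_harmonic_sum m n : (m <= n)%N -> harmonic_sum R m <= harmonic_sum R n.
Proof.
move=> mn; rewrite /harmonic_sum (big_cat_nat (leq0n m) mn)/= lerDl.
by apply: sumr_ge0 => k _; rewrite /harmonic/= invr_ge0.
Qed.

Lemma harmonic_sum_unbounded (M : R) : exists n, M < harmonic_sum R n.
Proof.
have := @nondecreasing_dvgn_lt R _ le_harmonic_sum (@dvg_harmonic R).
by move=> /cvgryPgt/(_ M)[n _ /(_ n (leqnn n))]; exists n.
Qed.

Lemma log_bump_shift_le n y z :
  `|log_bump n (lattice_translate z y) - log_bump n (lattice_point z)| <=
  \sum_(0 <= k < n) harmonic k * (crosses y z k.+1)%:R.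
Proof.
rewrite /log_bump -sumrB (le_trans (ler_norm_sum _ _ _))// ler_sum// => k _.
rewrite -mulrBr normrM ger0_norm ?invr_ge0// ler_wpM2l ?invr_ge0//.
rewrite /crosses; do 2 case: (inbox _ _);
  by rewrite ?subrr ?normr0 ?subr0 ?sub0r ?normrN ?normr1.
Qed.

(** After a first separating half-side k + 1, all the others lie in a window of
    length m, where the weights are at most 1/(k+1). *)
Lemma tail_crosses_le n m k y z : (forall i, `|tnth y i| <= m%:R) ->
  crosses y z k.+1 ->
  \sum_(k <= s < n) harmonic s * (crosses y z s.+1)%:R <=
  m%:R / k.+1%:R :> R.
Proof.
move=> ym ck.
have le1 s : (k <= s)%N -> harmonic s * (crosses y z s.+1)%:R <=
    (k.+1%:R)^-1 * (s < k + m)%N%:R :> R.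
  move=> ks; case E: (crosses y z s.+1); last first.
    by rewrite mulr0 mulr_ge0 ?invr_ge0.
  have := crosses_lt ym ck E; rewrite addSn ltnS => ->.
  by rewrite !mulr1 /harmonic/= lef_pV2 ?posrE// ler_nat.
apply: (@le_trans _ _ (\sum_(k <= s < n) (k.+1%:R)^-1 * (s < k + m)%N%:R)).
  by rewrite ler_sum_nat// => s /andP[ks _]; exact: le1.
rewrite -mulr_sumr mulrC ler_wpM2r ?invr_ge0// -natr_sum ler_nat.
rewrite -big_mkcond/=.
apply: (@leq_trans (\sum_(k <= s < k + m) 1)%N); last first.
  by rewrite sum_nat_const_nat addKn muln1.
rewrite [leqLHS](_ : _ = count (fun s => (s < k + m)%N) (index_iota k n)).
  rewrite sum1_size -size_filter; apply: uniq_leq_size.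
    by rewrite filter_uniq// iota_uniq.
  by move=> s; rewrite mem_filter !mem_index_iota => /andP[-> /andP[->]].
by rewrite -sum1_count.
Qed.

(** The separating half-side r contributes its weight 1/r, times at most
    O(r^(d-1) min(r, m)) lattice points, times a tail m/r of larger half-sides.
    This is at most a multiple of m^d / r for d <= 2, but not for d >= 3 and
    large r. *)
Lemma sum_log_bump_shift_sqr n m y F : d = 1%N \/ d = 2%N -> uniq F ->
  (forall i, `|tnth y i| <= m%:R) ->
  \sum_(z <- F)
     (log_bump n (lattice_translate z y) - log_bump n (lattice_point z)) ^+ 2 <=
  72 * m%:R ^+ d * harmonic_sum R n.
Proof.
move=> hd uF ym.
pose c z k : R := harmonic k * (crosses y z k.+1)%:R.
have c0 z k : 0 <= c z k by rewrite mulr_ge0// /harmonic/= invr_ge0.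
apply: (@le_trans _ _
    (\sum_(z <- F) 2 * \sum_(0 <= k < n) c z k * (m%:R / k.+1%:R))).
  apply: ler_sum => z _; rewrite -[leLHS]real_normK ?num_real//.
  apply: (@le_trans _ _ ((\sum_(0 <= k < n) c z k) ^+ 2)).
    by rewrite lerXn2r ?nnegrE ?sumr_ge0//; exact: log_bump_shift_le.
  apply: (le_trans (sqr_sum_le n (c0 z))); rewrite ler_wpM2l//.
  apply: ler_sum => k _.
  case E: (crosses y z k.+1); last by rewrite /c E mulr0 !mul0r.
  by rewrite ler_wpM2l//; exact: tail_crosses_le.
rewrite -mulr_sumr exchange_big/=.
under eq_bigr do rewrite -mulr_suml -mulr_sumr -natr_sum.
have -> : 72 * m%:R ^+ d * harmonic_sum R n =
    2 * \sum_(0 <= k < n) 36 * m%:R ^+ d * harmonic k :> R.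
  by rewrite -mulr_sumr /harmonic_sum; ring.
rewrite ler_wpM2l//; apply: ler_sum => k _.
have -> : (\sum_(z <- F) crosses y z k.+1 = count (crosses y ^~ k.+1) F)%N.
  by rewrite -sum1_count [RHS]big_mkcond/=; apply: eq_bigr => z _; case: crosses.
(* 36 = 4 * 3^2 covers the factors of count_crosses, with 2r + 1 <= 3r *)
have Nm : (count (crosses y ^~ k.+1) F * m <= 36 * m ^ d * k.+1)%N.
  apply: (leq_trans (leq_mul (count_crosses k.+1 uF ym) (leqnn m))).
  have := geq_minl k.+1.*2.+1 m; have := geq_minr k.+1.*2.+1 m.
  move: (minn _ _) => M Mm Mk.
  case: hd => -> /=; rewrite ?expn0 ?expn1 -?mulnn.
    by have := leq_mul Mk (leqnn m); lia.
  by have := leq_mul Mm (leqnn (k.+1 * m)); nia.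
have k0 : 0 < k.+1%:R :> R by rewrite ltr0n.
rewrite /harmonic/= mulrA ler_wpM2r ?invr_ge0// -mulrA mulrC ler_pdivrMr//.
by rewrite -natrX -!natrM ler_nat.
Qed.

End cubes.

Section vectors.
Context {R : realType} {d : nat}.
Implicit Types (x y : vec R d) (z : d.-tuple int).

Lemma abs_tnth_le_enorm x i : `|tnth x i| <= enorm x.
Proof.
rewrite -sqrtr_sqr /enorm ler_sqrt ?sumr_ge0// => [|j _]; last exact: sqr_ge0.
by rewrite (bigD1 i)//= lerDl sumr_ge0// => j _; exact: sqr_ge0.
Qed.

Lemma enorm_inbox r x : inbox r x -> enorm x <= d%:R * r%:R.
Proof.
move=> /forallP xr; rewrite -[leRHS]ger0_norm ?mulr_ge0// -sqrtr_sqr.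
rewrite /enorm ler_sqrt ?sqr_ge0//.
apply: (@le_trans _ _ (\sum_(i < d) r%:R ^+ 2)).
  apply: ler_sum => i _; rewrite -[leLHS]real_normK ?num_real//.
  by rewrite lerXn2r ?nnegrE.
rewrite sumr_const card_ord -[leLHS]mulr_natl exprMn ler_wpM2r ?sqr_ge0//.
by rewrite -natrX ler_nat; case: (d) => // k; rewrite expnS expn1 leq_pmulr.
Qed.

Lemma measurable_inbox r : measurable [set x : vec R d | inbox r x].
Proof.
rewrite (_ : [set x | _] =
    \bigcap_(i in [set: 'I_d]) ((@tnth _ R ^~ i) @^-1` `[- r%:R, r%:R])).
  apply: fin_bigcap_measurable => [|i _]; first exact: finite_finset.
  rewrite -[X in measurable X]setTI; exact: measurable_tnth.
apply/seteqP; split => x /=.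
  by move=> /forallP xr i _ /=; rewrite in_itv/= -ler_norml.
by move=> xr; apply/forallP => i; have := xr i I; rewrite /= in_itv/= -ler_norml.
Qed.

Lemma measurable_enorm : measurable_fun setT (@enorm R d).
Proof.
apply: (@measurableT_comp _ _ _ _ _ _ (@Num.sqrt R)).
  apply: continuous_measurable_fun; exact: sqrt_continuous.
apply: measurable_sum => i; apply: measurable_funX; exact: measurable_tnth.
Qed.

Lemma measurable_lattice_translate z : measurable_fun setT (@lattice_translate R d z).
Proof.
apply/measurable_fun_tnthP => i.
rewrite (_ : _ \o _ = (fun y => (tnth z i)%:~R + tnth y i)).
  apply: measurable_funD; [exact: measurable_cst|exact: measurable_tnth].
by apply/funext => y /=; rewrite tnth_mktuple.
Qed.

Lemma measurable_log_bump n : measurable_fun setT (@log_bump R d n).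
Proof.
apply: measurable_sum => k; apply: measurable_funM; first exact: measurable_cst.
rewrite (_ : (fun x => _) = \1_[set x | inbox k.+1 x]).
  by apply: measurable_indic; exact: measurable_inbox.
by apply/funext => x; rewrite indicE mem_setE/=.
Qed.

Lemma log_bump_ge0 n x : 0 <= log_bump n x.
Proof. by apply: sumr_ge0 => k _; rewrite mulr_ge0// /harmonic/= invr_ge0. Qed.

Lemma log_bump_le n x : log_bump n x <= harmonic_sum R n.
Proof.
apply: ler_sum => k _; rewrite ler_piMr ?lern1 ?leq_b1// /harmonic/= invr_ge0//.
Qed.

(** Only the radii below r can fail to contain x. *)
Lemma log_bump_ge r n x : (r <= n)%N -> inbox r x ->
  harmonic_sum R n - harmonic_sum R r <= log_bump n x.
Proof.
move=> rn xr; rewrite /harmonic_sum /log_bump !(big_cat_nat (leq0n r) rn)/=.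
rewrite addrAC subrr add0r ler_wpDl//.
  by apply: sumr_ge0 => k _; rewrite mulr_ge0// /harmonic/= invr_ge0.
apply: ler_sum_nat => k /andP[rk _].
by rewrite (inboxW _ xr) ?mulr1// leqW.
Qed.

Lemma exists_inbox x : exists r, inbox r x.
Proof.
exists (Num.truncn (enorm x)).+1; apply/forallP => i.
by rewrite (le_trans (abs_tnth_le_enorm x i))// ltW// truncnS_gt.
Qed.

(** Real shifts are rounded up to the integer m = floor |y| + 1, which replaces
    |y| by at most |y| + 1; the power (1 + |y|)^d is at most 4 (1 + |y|^d) for d
    <= 2. *)
Lemma sum_log_bump_shift_sqr_enorm n y (F : seq (d.-tuple int)) :
  d = 1%N \/ d = 2%N -> uniq F ->
  \sum_(z <- F)
     (log_bump n (lattice_translate z y) - log_bump n (lattice_point z)) ^+ 2 <=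
  288 * harmonic_sum R n * (1 + enorm y ^+ d).
Proof.
move=> hd uF; pose m := (Num.truncn (enorm y)).+1.
have e0 : 0 <= enorm y by exact: sqrtr_ge0.
have em : enorm y < m%:R by exact: truncnS_gt.
have me : m%:R <= enorm y + 1.
  by rewrite -natr1 lerD2r truncn_le.
apply: (le_trans (@sum_log_bump_shift_sqr _ _ n m y F hd uF _)).
  by move=> i; rewrite (le_trans (abs_tnth_le_enorm y i))// ltW.
have -> : 72 * m%:R ^+ d * harmonic_sum R n = harmonic_sum R n * 72 * m%:R ^+ d :> R
  by ring.
have -> : 288 * harmonic_sum R n * (1 + enorm y ^+ d) =
   harmonic_sum R n * 72 * (4 * (1 + enorm y ^+ d)) :> R by ring.
rewrite ler_wpM2l ?mulr_ge0 ?harmonic_sum_ge0//.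
have m0 : 0 <= m%:R :> R by [].
move: (enorm y) (m%:R : R) e0 me m0 => e M e0 me m0.
have MM : M * M <= (e + 1) * (e + 1) by rewrite ler_pM.
have e1 := sqr_ge0 (e - 1); rewrite expr2 in e1.
by case: hd => ->; rewrite ?expr1 ?expr2; lra.
Qed.

End vectors.

(** * Second moments of bounded random variables *)

Lemma measurable_fun_abs_gt (disp : measure_display) (T : measurableType disp)
    (R : realType) (f : T -> R) (a b : R) : measurable_fun setT f ->
  measurable [set w | a < `|f w - b|].
Proof.
move=> mf; have mg : measurable_fun setT (fun x => `|f x - b|).
  apply: measurableT_comp => //; apply: measurable_funB; [exact: mf|].
  exact: measurable_cst.
rewrite (_ : [set x | _] = setT `&` (fun x => `|f x - b|) @^-1` `]a, +oo[); last first.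
  by rewrite setTI; apply/seteqP; split => x /=; rewrite in_itv/= andbT.
exact: mg.
Qed.

Section bounded_variables.
Context {disp : measure_display} {T : measurableType disp} {R : realType}.
Context (P : probability T R).
Implicit Types (f g : T -> R) (a c : R).

(** Closed under the ring operations and integrable for every probability, so
    that the second-moment computations below carry no integrability
    conditions. *)
Definition bdd_mfun f := measurable_fun setT f /\ exists M : R, forall x, `|f x| <= M.

Lemma bdd_mfun_integrable f : bdd_mfun f -> P.-integrable setT (EFin \o f).
Proof.
move=> [mf [M fM]]; apply: measurable_bounded_integrable => //.
  exact: le_lt_trans (probability_le1 P measurableT) (ltry _).
exists M; split; first exact: num_real.
by move=> r Mr x _; rewrite /= (le_trans (fM x))// ltW.
Qed.

Lemma bdd_mfun_cst c : bdd_mfun (fun=> c).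
Proof. by split; [exact: measurable_cst|exists `|c|]. Qed.

Lemma bdd_mfunD f g : bdd_mfun f -> bdd_mfun g -> bdd_mfun (fun x => f x + g x).
Proof.
move=> [mf [M fM]] [mg [N gN]]; split; first exact: measurable_funD.
by exists (M + N) => x; rewrite (le_trans (ler_normD _ _))// lerD.
Qed.

Lemma bdd_mfunM f g : bdd_mfun f -> bdd_mfun g -> bdd_mfun (fun x => f x * g x).
Proof.
move=> [mf [M fM]] [mg [N gN]]; split; first exact: measurable_funM.
by exists (M * N) => x; rewrite normrM ler_pM.
Qed.

Lemma bdd_mfunZ c f : bdd_mfun f -> bdd_mfun (fun x => c * f x).
Proof. exact/bdd_mfunM/bdd_mfun_cst. Qed.

Lemma bdd_mfunB f g : bdd_mfun f -> bdd_mfun g -> bdd_mfun (fun x => f x - g x).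
Proof.
move=> bf bg; rewrite (_ : (fun x => _) = (fun x => f x + -1 * g x)).
  exact/bdd_mfunD/bdd_mfunZ.
by apply/funext => x; rewrite mulN1r.
Qed.

Lemma bdd_mfunX f n : bdd_mfun f -> bdd_mfun (fun x => f x ^+ n).
Proof.
move=> bf; elim: n => [|n IH]; first exact: bdd_mfun_cst.
by under eq_fun do rewrite exprS; exact: bdd_mfunM.
Qed.

Lemma bdd_mfun_sum (I : Type) (s : seq I) (X : I -> T -> R) :
  (forall i, bdd_mfun (X i)) -> bdd_mfun (fun x => \sum_(i <- s) X i x).
Proof.
move=> bX; elim: s => [|i s IH].
  by under eq_fun do rewrite big_nil; exact: bdd_mfun_cst.
by under eq_fun do rewrite big_cons; exact: bdd_mfunD.
Qed.

Lemma bdd_mfun_indic (p : pred T) : measurable [set x | p x] ->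
  bdd_mfun (fun x => (p x)%:R).
Proof.
move=> mp; split; last by exists 1 => x; case: (p x); rewrite ?normr0 ?normr1.
rewrite (_ : (fun x => _) = \1_[set x | p x]); first exact: measurable_indic.
by apply/funext => x; rewrite indicE mem_setE/=.
Qed.

Definition mean f : R := \int[P]_x f x.

Lemma mean_cst c : mean (fun=> c) = c.
Proof.
rewrite /mean Rintegral_cst// [X in fine X](_ : _ = 1%E) ?mulr1//.
exact: (probability_setT P).
Qed.

Lemma meanD f g : bdd_mfun f -> bdd_mfun g ->
  mean (fun x => f x + g x) = mean f + mean g.
Proof. by move=> bf bg; rewrite /mean RintegralD//; exact: bdd_mfun_integrable. Qed.

Lemma meanZ c f : bdd_mfun f -> mean (fun x => c * f x) = c * mean f.
Proof. by move=> bf; rewrite /mean RintegralZl//; exact: bdd_mfun_integrable. Qed.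

Lemma meanB f g : bdd_mfun f -> bdd_mfun g ->
  mean (fun x => f x - g x) = mean f - mean g.
Proof. by move=> bf bg; rewrite /mean RintegralB//; exact: bdd_mfun_integrable. Qed.

Lemma mean_sum (I : Type) (s : seq I) (X : I -> T -> R) :
  (forall i, bdd_mfun (X i)) ->
  mean (fun x => \sum_(i <- s) X i x) = \sum_(i <- s) mean (X i).
Proof.
move=> bX; elim: s => [|i s IH].
  by under eq_fun do rewrite big_nil; rewrite big_nil mean_cst.
under eq_fun do rewrite big_cons.
by rewrite meanD ?big_cons ?IH//; exact: bdd_mfun_sum.
Qed.

Lemma le_mean f g : bdd_mfun f -> bdd_mfun g -> (forall x, f x <= g x) ->
  mean f <= mean g.
Proof. by move=> bf bg fg; apply: le_Rintegral => //; exact: bdd_mfun_integrable. Qed.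

Lemma mean_indic (p : pred T) : measurable [set x | p x] ->
  mean (fun x => (p x)%:R) = fine (P [set x | p x]).
Proof.
move=> mp; rewrite /mean /Rintegral.
under eq_integral => x _.
  rewrite (_ : (p x)%:R = \1_[set x | p x] x); last by rewrite indicE mem_setE.
  over.
by rewrite integral_indic// setIT.
Qed.

(** The mean squared distance to a exceeds the variance by [(mean f - a)^2]. *)
Lemma mean_centered_sqr_le f a : bdd_mfun f ->
  mean (fun x => (f x - mean f) ^+ 2) <= mean (fun x => (f x - a) ^+ 2).
Proof.
move=> bf; set e := mean f.
have -> : (fun x => (f x - a) ^+ 2) =
    (fun x => (f x - e) ^+ 2 + (2 * (e - a) * f x + (a ^+ 2 - e ^+ 2))).
  by apply/funext => x; ring.
have ? : bdd_mfun (fun x => (f x - e) ^+ 2) by exact/bdd_mfunX/bdd_mfunB/bdd_mfun_cst.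
have ? : bdd_mfun (fun x => 2 * (e - a) * f x) by exact: bdd_mfunZ.
rewrite [leRHS]meanD//; last exact/bdd_mfunD/bdd_mfun_cst.
rewrite meanD//; last exact/bdd_mfun_cst.
rewrite mean_cst meanZ// -/e lerDl.
by have := sqr_ge0 (e - a); lra.
Qed.

(** Bienayme's identity: after centring, uncorrelated variables are
    orthogonal. *)
Lemma mean_sqr_sum (I : eqType) (s : seq I) (X : I -> T -> R) : uniq s ->
  (forall i, bdd_mfun (X i)) ->
  (forall i j, i != j -> mean (fun x => X i x * X j x) = mean (X i) * mean (X j)) ->
  mean (fun x => (\sum_(i <- s) X i x - \sum_(i <- s) mean (X i)) ^+ 2) =
  \sum_(i <- s) mean (fun x => (X i x - mean (X i)) ^+ 2).
Proof.
move=> us bX indX; pose C i x := X i x - mean (X i).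
have bC i : bdd_mfun (C i) by exact/bdd_mfunB/bdd_mfun_cst.
have C0 i : mean (C i) = 0 by rewrite meanB ?mean_cst ?subrr//; exact: bdd_mfun_cst.
have CC i j : i != j -> mean (fun x => C i x * C j x) = 0.
  move=> ij; rewrite (_ : (fun x => _) =
    (fun x => X i x * X j x - (mean (X j) * X i x + mean (X i) * C j x))); last first.
    by apply/funext => x; rewrite /C; ring.
  rewrite meanB; [|exact: bdd_mfunM|by apply: bdd_mfunD; exact: bdd_mfunZ].
  by rewrite meanD ?meanZ ?C0 ?indX//; [ring|exact: bdd_mfunZ|exact: bdd_mfunZ].
under eq_fun do rewrite -sumrB.
elim: s us => [|i s IH] /=.
  move=> _; rewrite big_nil.
  by under eq_fun do rewrite big_nil expr0n/=; exact: mean_cst.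
move=> /andP[nis us]; rewrite big_cons -IH//.
have bS : bdd_mfun (fun x => \sum_(j <- s) C j x) by exact: bdd_mfun_sum.
rewrite (_ : (fun x => _) = (fun x => C i x ^+ 2 +
  ((\sum_(j <- s) C j x) ^+ 2 + 2 * \sum_(j <- s) C i x * C j x))); last first.
  by apply/funext => x; rewrite big_cons -mulr_sumr /C; ring.
have bCS : bdd_mfun (fun x => \sum_(j <- s) C i x * C j x).
  by apply: bdd_mfun_sum => j; exact: bdd_mfunM.
rewrite meanD;
  [|exact: bdd_mfunX|by apply: bdd_mfunD; [exact: bdd_mfunX|exact: bdd_mfunZ]].
rewrite meanD; [|exact: bdd_mfunX|exact: bdd_mfunZ].
rewrite meanZ// mean_sum; last by move=> j; exact: bdd_mfunM.
rewrite [X in 2 * X]big1_seq ?mulr0 ?addr0// => j /= js; apply: CC.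
by apply: contraNneq nis => ->.
Qed.

Lemma chebyshev_bdd_mfun f a e : bdd_mfun f -> 0 < e ->
  (P [set x | (e < `|f x - a|)%R] <= (mean (fun x => (f x - a) ^+ 2) / e ^+ 2)%R%:E)%E.
Proof.
move=> bf e0.
have mA := measurable_fun_abs_gt e a bf.1.
rewrite -[leLHS]fineK ?fin_num_measure// lee_fin -mean_indic//.
rewrite ler_pdivlMr ?exprn_gt0// mulrC -meanZ; last exact: bdd_mfun_indic.
apply: le_mean => [||x].
- exact/bdd_mfunZ/bdd_mfun_indic.
- exact/bdd_mfunX/bdd_mfunB/bdd_mfun_cst.
case: ltP => [eh|_]; last by rewrite mulr0 sqr_ge0.
by rewrite mulr1 -[leRHS]real_normK ?num_real// lerXn2r ?nnegrE// ltW.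
Qed.

End bounded_variables.

(** * Variance of the smoothed count of the perturbed lattice *)

Section concentration.
Context {R : realType} {d : nat} {disp : measure_display}
  {Omega : measurableType disp}.
Context (P : probability Omega R) (Y : d.-tuple int -> {RV P >-> vec R d}).
Context (Y_iid : iid P (fun z => Y z : Omega -> vec R d)).
Context (hd : d = 1%N \/ d = 2%N).
Context (Y_moment :
  ('E_P[(fun w => enorm (Y (origin d) w) ^+ d)%R] < +oo)%E).

Definition log_bump_at (n : nat) (z : d.-tuple int) (w : Omega) : R :=
  log_bump n (lattice_translate z (Y z w)).

(** Both sides are integrals of f against the law of the variable. *)
Lemma mean_same_law (X X' : {RV P >-> vec R d}) (f : vec R d -> R) :
  same_law P P (X : Omega -> _) (X' : Omega -> _) -> bdd_mfun f ->
  mean P (f \o X) = mean P (f \o X').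
Proof.
move=> XX' [mf [M fM]]; rewrite /mean /Rintegral; congr fine.
have mEf : measurable_fun setT (EFin \o f) by exact/measurable_EFinP.
have bf (Z : {RV P >-> vec R d}) : P.-integrable setT ((EFin \o f) \o Z).
  apply: (@bdd_mfun_integrable _ _ _ P (f \o Z)); split; last by exists M => w /=.
  exact: measurableT_comp.
rewrite -(integral_distribution mEf (bf X)) -(integral_distribution mEf (bf X')).
by apply: eq_measure_integral => A mA _; exact: XX'.
Qed.

Lemma bdd_mfun_comp (X : {RV P >-> vec R d}) (f : vec R d -> R) :
  bdd_mfun f -> bdd_mfun (fun w => f (X w)).
Proof.
by move=> [mf [M fM]]; split; [exact: measurableT_comp|exists M => w].
Qed.

Lemma bdd_mfun_log_bump_translate n z :
  bdd_mfun (fun y : vec R d => log_bump n (lattice_translate z y)).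
Proof.
split; last first.
  by exists (harmonic_sum R n) => y; rewrite ger0_norm ?log_bump_ge0// log_bump_le.
apply: measurableT_comp; first exact: measurable_log_bump.
exact: measurable_lattice_translate.
Qed.

Lemma bdd_mfun_log_bump_at n z : bdd_mfun (log_bump_at n z).
Proof. exact: (@bdd_mfun_comp (Y z) _ (bdd_mfun_log_bump_translate n z)). Qed.

Lemma measurable_inbox_translate r z :
  measurable [set y : vec R d | inbox r (lattice_translate z y)].
Proof.
rewrite -[X in measurable X]setTI.
exact: (measurable_lattice_translate z measurableT (measurable_inbox r)).
Qed.

Lemma measurable_hit r z :
  measurable [set w | inbox r (lattice_translate z (Y z w))].
Proof.
rewrite -[X in measurable X]setTI.
have mY : measurable_fun setT (Y z : Omega -> vec R d) by [].
exact: (mY measurableT _ (measurable_inbox_translate r z)).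
Qed.

Lemma indep_hit r s z z' : z != z' ->
  P ([set w | inbox r (lattice_translate z (Y z w))] `&`
     [set w | inbox s (lattice_translate z' (Y z' w))]) =
  (P [set w | inbox r (lattice_translate z (Y z w))] *
   P [set w | inbox s (lattice_translate z' (Y z' w))])%E.
Proof.
move=> zz'; pose k u := if u == z then r else s.
have := Y_iid.1 [:: z; z'] (fun u => [set y | inbox (k u) (lattice_translate u y)]).
rewrite /= inE zz' => /(_ erefl); rewrite big_cons big_seq1.
have kz : k z = r by rewrite /k eqxx.
have kz' : k z' = s by rewrite /k eq_sym (negbTE zz').
rewrite kz kz' => indepE.
etransitivity; last first.
  by apply: indepE => u; exact: measurable_inbox_translate.
congr (P _); apply/seteqP; split => w /=.
  by move=> [h1 h2] u /=; rewrite !inE => /orP[] /eqP ->; rewrite /= ?kz ?kz'.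
move=> h; split.
  by have /= := h z; rewrite inE eqxx kz; exact.
by have /= := h z'; rewrite !inE eqxx orbT kz'; exact.
Qed.

(** [log_bump] is a finite combination of indicators of cubes, so that the
    product rule for events suffices. *)
Lemma log_bump_at_uncorrelated n z z' : z != z' ->
  mean P (fun w => log_bump_at n z w * log_bump_at n z' w) =
  mean P (log_bump_at n z) * mean P (log_bump_at n z').
Proof.
move=> zz'.
pose I r u w : R := (inbox r (lattice_translate u (Y u w)))%:R.
have bI r u : bdd_mfun (I r u) by apply: bdd_mfun_indic; exact: measurable_hit.
have II r s : mean P (fun w => I r z w * I s z' w) =
    mean P (I r z) * mean P (I s z').
  have -> : (fun w => I r z w * I s z' w) =
    (fun w => (inbox r (lattice_translate z (Y z w)) &&
               inbox s (lattice_translate z' (Y z' w)))%:R).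
    by apply/funext => w; rewrite /I -natrM mulnb.
  rewrite mean_indic; last first.
    rewrite (_ : [set w | _] = [set w | inbox r (lattice_translate z (Y z w))] `&`
     [set w | inbox s (lattice_translate z' (Y z' w))]).
      by apply: measurableI; exact: measurable_hit.
    by apply/seteqP; split => w /= /andP.
  rewrite /I !mean_indic; [|exact: measurable_hit..].
  rewrite -fineM ?fin_num_measure//; [|exact: measurable_hit..].
  rewrite -indep_hit//; congr (fine (P _)).
  by apply/seteqP; split => w /= /andP.
have E u : log_bump_at n u = (fun w => \sum_(0 <= k < n) harmonic k * I k.+1 u w) by [].
rewrite !E; under eq_fun do rewrite mulr_suml.
rewrite !mean_sum => [|k|k|k].
- rewrite mulr_suml; apply: eq_bigr => k _.
  under eq_fun do rewrite mulr_sumr.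
  rewrite mean_sum; last by move=> s; apply: bdd_mfunM; exact: bdd_mfunZ.
  rewrite mulr_sumr; apply: eq_bigr => s _.
  under eq_fun do rewrite mulrACA.
  by rewrite meanZ ?II ?meanZ//; [ring|exact: bdd_mfunM].
- exact: bdd_mfunZ.
- exact: bdd_mfunZ.
- apply: bdd_mfunM; first exact: bdd_mfunZ.
  by apply: bdd_mfun_sum => s; exact: bdd_mfunZ.
Qed.

(** A bound for the variance of the smoothed count in units of the harmonic
    sum. *)
Definition moment_bound : R :=
  288 * (1 + mean P (fun w => enorm (Y (origin d) w) ^+ d)).

(** The deterministic estimate is integrated against the common law of the
    perturbations; the bound does not depend on the finite set F, which allows F
    to exhaust the lattice afterwards. *)
Lemma variance_log_bump_le n (F : seq (d.-tuple int)) : uniq F ->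
  mean P (fun w => (\sum_(z <- F) log_bump_at n z w -
                    \sum_(z <- F) mean P (log_bump_at n z)) ^+ 2) <=
  moment_bound * harmonic_sum R n.
Proof.
move=> uF; rewrite mean_sqr_sum//;
  [|exact: bdd_mfun_log_bump_at|exact: log_bump_at_uncorrelated].
pose g (z : d.-tuple int) (y : vec R d) : R :=
  (log_bump n (lattice_translate z y) - log_bump n (lattice_point z)) ^+ 2.
have bg z : bdd_mfun (g z).
  exact/bdd_mfunX/bdd_mfunB/bdd_mfun_cst/bdd_mfun_log_bump_translate.
apply: (@le_trans _ _ (\sum_(z <- F) mean P (g z \o Y (origin d)))).
  apply: ler_sum => z _.
  apply: (le_trans
    (mean_centered_sqr_le P (log_bump n (lattice_point z)) (bdd_mfun_log_bump_at n z))).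
  by rewrite -(mean_same_law (Y_iid.2 z (origin d)) (bg z)).
rewrite -mean_sum; last by move=> z; exact: bdd_mfun_comp.
pose h w := enorm (Y (origin d) w) ^+ d.
have mh : measurable_fun setT h.
  by apply: measurable_funX; apply: measurableT_comp => //; exact: measurable_enorm.
have h0 w : 0 <= h w by rewrite exprn_ge0// sqrtr_ge0.
have ih : P.-integrable setT (EFin \o h).
  apply/integrableP; split; first exact/measurable_EFinP.
  move: Y_moment; rewrite unlock; apply: le_lt_trans.
  rewrite le_eqVlt; apply/orP; left; apply/eqP.
  by apply: eq_integral => w _; rewrite /= ger0_norm.
have i1 : P.-integrable setT (EFin \o (fun w => 1 + h w)).
  exact: (integrableD _ (bdd_mfun_integrable P (bdd_mfun_cst 1)) ih).
have i2 : P.-integrable setT (EFin \o (fun w => 288 * harmonic_sum R n * (1 + h w))).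
  exact: (integrableZl _ _ i1).
rewrite /moment_bound.
have -> : 288 * (1 + mean P h) * harmonic_sum R n =
    mean P (fun w => 288 * harmonic_sum R n * (1 + h w)).
  rewrite {2}/mean RintegralZl// RintegralD//;
    last exact/bdd_mfun_integrable/bdd_mfun_cst.
  by rewrite -!/(mean P _) mean_cst; ring.
apply: le_Rintegral => //.
  by apply: bdd_mfun_integrable; apply: bdd_mfun_sum => z; exact: bdd_mfun_comp.
by move=> w _; exact: sum_log_bump_shift_sqr_enorm.
Qed.

(** Chebyshev's inequality: the variance is of order H_n and the deviation of
    order H_n. *)
Lemma log_bump_concentration n (F : seq (d.-tuple int)) : (0 < n)%N -> uniq F ->
  (P [set w | (harmonic_sum R n / 4 < `|\sum_(z <- F) log_bump_at n z w -
                  \sum_(z <- F) mean P (log_bump_at n z)|)%R] <=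
   (16 * moment_bound / harmonic_sum R n)%:E)%E.
Proof.
move=> n0 uF.
have h0 : 0 < harmonic_sum R n.
  rewrite /harmonic_sum; case: n n0 => // n _; rewrite big_nat_recl// ltr_wpDr//.
    by apply: sumr_ge0 => k _; rewrite /harmonic/= invr_ge0.
  by rewrite /harmonic/= invr_gt0.
apply: (le_trans (chebyshev_bdd_mfun P _ (bdd_mfun_sum _ (bdd_mfun_log_bump_at n)) _)).
  by rewrite divr_gt0.
rewrite lee_fin.
have -> : 16 * moment_bound / harmonic_sum R n =
    (moment_bound * harmonic_sum R n) / (harmonic_sum R n / 4) ^+ 2.
  by field; rewrite gt_eqF.
by rewrite ler_wpM2r ?invr_ge0 ?sqr_ge0//; exact: variance_log_bump_le.
Qed.

End concentration.

(** * The smoothed count as a functional of point measures *)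

Lemma counting_seq (T : choiceType) (R : realType) (s : seq T) : uniq s ->
  counting [set` s] = (size s)%:R%:E :> \bar R.
Proof.
move=> us; have fs : finite_set [set` s] by exact: finite_seq.
rewrite /counting asboolT//; congr ((_)%:R%:E).
apply/perm_size/uniq_perm => //.
by move=> x; rewrite in_fset_set// mem_setE.
Qed.

Section statistic.
Context {R : realType} {d : nat}.
Implicit Types (mu : set_function R d) (x : vec R d).

(** The integral of [log_bump n] against mu, written through the masses of
    cubes; this makes measurability in mu immediate. Taking [fine] is harmless
    for locally finite measures. *)
Definition smoothed_count (n : nat) mu : R :=
  \sum_(0 <= k < n) harmonic k * fine (mu [set x | inbox k.+1 x]).

Lemma measurable_evaluation (A : set (vec R d)) : measurable A ->
  measurable_fun setT (fun mu : set_function R d => mu A).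
Proof.
move=> mA _ B mB; rewrite setTI; apply: sub_sigma_algebra.
by exists A, B; split.
Qed.

Lemma measurable_smoothed_count n : measurable_fun setT (smoothed_count n).
Proof.
apply: measurable_sum => k; apply: measurable_funM; first exact: measurable_cst.
apply: measurableT_comp; first exact: fine_measurable.
exact: (measurable_evaluation (measurable_inbox _)).
Qed.

Lemma measurable_to_set_function (disp : measure_display) (T : measurableType disp)
    (f : T -> set_function R d) :
  (forall A, measurable A -> measurable_fun setT (fun t => f t A)) ->
  measurable_fun setT f.
Proof.
move=> mf.
pose G := @evaluation_events R d.
have := @measurability _ _ T (g_sigma_algebraType G) setT f G erefl; apply.
move=> _ [_ [A [B [mA mB ->]]] <-].
exact: (mf A mA measurableT B mB).
Qed.

Lemma measurable_add_point (disp : measure_display) (T : measurableType disp)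
    (f : T -> set_function R d) (g : T -> vec R d) :
  measurable_fun setT f -> measurable_fun setT g ->
  measurable_fun setT (fun t => add_point (f t) (g t)).
Proof.
move=> mf mg; apply: measurable_to_set_function => A mA.
apply: emeasurable_funD.
  exact: (measurableT_comp (measurable_evaluation mA) mf).
exact: (measurableT_comp (measurable_fun_dirac mA) mg).
Qed.

Lemma measurable_remove_point (disp : measure_display) (T : measurableType disp)
    (f : T -> set_function R d) (g : T -> vec R d) :
  measurable_fun setT f -> measurable_fun setT g ->
  measurable_fun setT (fun t => remove_point (f t) (g t)).
Proof.
move=> mf mg; apply: measurable_to_set_function => A mA.
apply: emeasurable_funB.
  exact: (measurableT_comp (measurable_evaluation mA) mf).
exact: (measurableT_comp (measurable_fun_dirac mA) mg).
Qed.

Lemma finite_inbox (C : set (vec R d)) r :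
  locally_finite C -> finite_set ([set x | inbox r x] `&` C).
Proof.
move=> /(_ (d%:R * r%:R)); apply: sub_finite_set => x [xr Cx]; split=> //.
exact: enorm_inbox.
Qed.

Lemma fin_inbox mu r : simple_point_measure mu ->
  mu [set x | inbox r x] \is a fin_num.
Proof.
move=> [C [Cf ->]]; last exact: measurable_inbox.
by rewrite /counting asboolT//; exact: finite_inbox.
Qed.

Lemma smoothed_count_add_point n mu x : simple_point_measure mu ->
  smoothed_count n (add_point mu x) = smoothed_count n mu + log_bump n x.
Proof.
move=> smu; rewrite /smoothed_count /log_bump -big_split/=; apply: eq_bigr => k _.
by rewrite -mulrDr /add_point diracE fineD ?(fin_inbox _ smu)// mem_setE.
Qed.

Lemma smoothed_count_remove_point n mu x : simple_point_measure mu ->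
  smoothed_count n (remove_point mu x) = smoothed_count n mu - log_bump n x.
Proof.
move=> smu; rewrite /smoothed_count /log_bump -sumrB; apply: eq_bigr => k _.
by rewrite -mulrBr /remove_point diracE fineB ?(fin_inbox _ smu)// mem_setE.
Qed.

Lemma measurable_vec1 x : measurable [set x].
Proof.
rewrite (_ : [set x] = \bigcap_(i in [set: 'I_d])
    ((@tnth _ R ^~ i) @^-1` [set tnth x i])).
  apply: fin_bigcap_measurable => [|i _]; first exact: finite_finset.
  rewrite -[X in measurable X]setTI; exact: measurable_tnth.
apply/seteqP; split => y /=; first by move=> -> i _.
by move=> yx; apply: eq_from_tnth => i; exact: yx.
Qed.

Lemma counting_inter1 (C : set (vec R d)) x :
  counting ([set x] `&` C) = 1%E :> \bar R <-> C x.
Proof.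
split=> [|Cx].
  apply: contraPP => Cx; rewrite (_ : _ `&` _ = [set` [::]]).
    by rewrite counting_seq// => /eqP; rewrite eqe eq_sym oner_eq0.
  by apply/seteqP; split => y //= -[->].
rewrite (_ : _ `&` _ = [set` [:: x]]) ?counting_seq//.
apply/seteqP; split => y /=; first by move=> [-> _]; rewrite inE.
by rewrite inE => /eqP ->.
Qed.

Lemma point_supportE mu (C : set (vec R d)) :
  (forall A, measurable A -> mu A = counting (A `&` C)) -> point_support mu = C.
Proof.
move=> muC; apply/seteqP; split => x; rewrite /point_support/= muC;
  by [exact: measurable_vec1|move/counting_inter1].
Qed.

(** Only the indices whose point falls in the largest of the cubes contribute to
    the count. *)
Lemma smoothed_count_range (I : choiceType) (g : I -> vec R d) n mu (F : seq I) :
  simple_point_measure mu -> point_support mu = range g -> injective g ->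
  uniq F -> (forall i, inbox n (g i) -> i \in F) ->
  smoothed_count n mu = \sum_(i <- F) log_bump n (g i).
Proof.
move=> [C [Cf muC]] supp ginj uF FP.
rewrite (point_supportE muC) in supp.
rewrite /log_bump exchange_big; apply: eq_big_nat => k /andP[_ kn].
rewrite -mulr_sumr; congr (_ * _).
rewrite muC; last exact: measurable_inbox.
rewrite (_ : _ `&` _ = [set` [seq g i | i <- F & inbox k.+1 (g i)]]).
  rewrite counting_seq ?map_inj_uniq ?filter_uniq//= size_map size_filter.
  by rewrite -sum1_count big_mkcond natr_sum; apply: eq_bigr => i _; case: inbox.
rewrite supp; apply/seteqP; split => x /=.
  move=> [xk [i _ gix]]; rewrite -gix in xk *; apply: map_f.
  by rewrite mem_filter xk FP// (inboxW kn).
by move=> /mapP[i]; rewrite mem_filter => /andP[ik _] ->; split=> //; exists i.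
Qed.

(** The injectivity of g turns the local finiteness of its range into a finite
    number of indices. *)
Lemma finite_hits (I : Type) (g : I -> vec R d) n mu :
  simple_point_measure mu -> point_support mu = range g -> injective g ->
  finite_set [set i | inbox n (g i)].
Proof.
move=> [C [Cf muC]]; rewrite (point_supportE muC) => supp ginj.
have gI : {in g @^-1` ([set x | inbox n x] `&` C) &, injective g}.
  by move=> i j _ _; exact: ginj.
apply: sub_finite_set (finite_preimage gI (finite_inbox n Cf)).
by move=> i /= gi; split=> //; rewrite supp; exists i.
Qed.

End statistic.

(** * A null event that no one-point modification avoids *)

Section singular.
Context {R : realType} {d : nat} {disp : measure_display}
  {Omega : measurableType disp}.
Context (P : probability Omega R) (Y : d.-tuple int -> {RV P >-> vec R d}).
Context (Lambda : {RV P >-> set_function R d}).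
Context (Y_iid : iid P (fun z => Y z : Omega -> vec R d)).
Context (hd : d = 1%N \/ d = 2%N).
Context (Y_moment :
  ('E_P[(fun w => enorm (Y (origin d) w) ^+ d)%R] < +oo)%E).
Context (Lambda_pp : point_process Lambda).
Context (Lambda_supp : {ae P, forall w, point_support (Lambda w) =
       range (fun z : d.-tuple int => lattice_translate z (Y z w))}).
Context (Lambda_simple : {ae P, forall w,
       injective (fun z : d.-tuple int => lattice_translate z (Y z w))}).

(** Almost surely only finitely many lattice points are sent into the cube of
    half-side n. Along an enumeration of the lattice, the events that a point of
    rank at least k is sent there therefore decrease to a null event. *)
Lemma smoothed_count_exhaustion n (e : R) : 0 < e ->
  exists F : seq (d.-tuple int), uniq F /\ exists U : set Omega,
    [/\ measurable U, (P U <= e%:E)%E & forall w, ~ U w ->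
       smoothed_count n (Lambda w) = \sum_(z <- F) log_bump_at Y n z w].
Proof.
move=> e0.
(* the j-th lattice point of the enumeration is sent into the cube *)
pose E (j : nat) : set Omega :=
  if pickle_inv j is Some z then [set w | inbox n (lattice_translate z (Y z w))]
  else set0.
have mE j : measurable (E j).
  by rewrite /E; case: pickle_inv => // z; exact: measurable_hit.
have [N [mN N0 NP]] : {ae P, forall w, point_support (Lambda w) =
       range (fun z : d.-tuple int => lattice_translate z (Y z w)) /\
       injective (fun z : d.-tuple int => lattice_translate z (Y z w))}.
  exact: filterS2 Lambda_supp Lambda_simple.
have NP' w : ~ N w -> point_support (Lambda w) =
       range (fun z : d.-tuple int => lattice_translate z (Y z w)) /\
       injective (fun z : d.-tuple int => lattice_translate z (Y z w)).
  by move=> Nw; apply: contrapT => h; apply: Nw; exact: NP.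
have limE0 : P (lim_sup_set E) = 0%E.
  have mL : measurable (lim_sup_set E).
    by apply: bigcapT_measurable => k; apply: bigcup_measurable => j _.
  apply/eqP; rewrite eq_le measure_ge0 andbT -N0.
  apply: le_measure; rewrite ?inE// => w limw.
  apply: contrapT => /NP'[supp ginj].
  have fin := finite_hits n (Lambda_pp w) supp ginj.
  pose S := [set z : d.-tuple int | inbox n (lattice_translate z (Y z w))].
  pose M := \max_(z <- finmap.enum_fset (fset_set S)) pickle z.
  have [j /= Mj] := limw M.+1 I.
  rewrite /E; case Ej: (pickle_inv j) => [z|]//= zn.
  have := @pickle_invK (d.-tuple int) j; rewrite Ej /= => zj.
  move: Mj; rewrite ltnNge -zj => /negP; apply.
  by apply: (@leq_bigmax_seq _ _ xpredT) => //; rewrite in_fset_set// mem_setE.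
have [k Pk] : exists k, (P (\bigcup_(j >= k) E j) <= e%:E)%E.
  apply: contrapT => /forallNP hk.
  have cv : P (\bigcup_(j >= k) E j) @[k --> \oo] --> 0%E.
    rewrite -limE0; apply: lim_sup_set_cvg => //.
    apply: le_lt_trans (probability_le1 P _) (ltry _).
    by apply: bigcup_measurable => j _.
  have : (e%:E <= lim (P (\bigcup_(j >= k) E j) @[k --> \oo]))%E.
    apply: lime_ge; first by apply/cvg_ex; exists 0%E.
    by apply: nearW => k; apply/ltW; rewrite ltNge; exact/negP/hk.
  by rewrite (cvg_lim _ cv)// lee_fin leNgt e0.
pose F := pmap (@pickle_inv (d.-tuple int)) (iota 0 k).
have memF z : (pickle z < k)%N -> z \in F.
  move=> zk; rewrite mem_pmap -(pickleK_inv z); apply: map_f.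
  by rewrite mem_iota.
have uF : uniq F by apply: (pmap_uniq (@pickle_invK _)); exact: iota_uniq.
have mU : measurable (\bigcup_(j >= k) E j) by apply: bigcup_measurable => j _.
exists F; split=> //; exists ((\bigcup_(j >= k) E j) `|` N); split.
- exact: measurableU.
- by rewrite measureU0.
- move=> w /not_orP[Uw /NP'[supp ginj]].
  apply: (smoothed_count_range (Lambda_pp w) supp ginj uF) => z zn.
  apply: memF; rewrite ltnNge; apply/negP => kz; apply: Uw.
  by exists (pickle z) => //; rewrite /E pickleK_inv.
Qed.

Lemma smoothed_count_concentration n (e : R) : (0 < n)%N -> 0 < e ->
  exists c : R,
   (P [set w | (harmonic_sum R n / 4 < `|smoothed_count n (Lambda w) - c|)%R] <=
    (16 * moment_bound Y / harmonic_sum R n + e)%R%:E)%E.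
Proof.
move=> n0 e0; have [F [uF [U [mU PU UP]]]] := smoothed_count_exhaustion n e0.
exists (\sum_(z <- F) mean P (log_bump_at Y n z)).
set c := \sum_(z <- F) _.
have mL : measurable_fun setT (fun w => smoothed_count n (Lambda w)).
  by apply: measurableT_comp => //; exact: measurable_smoothed_count.
have mW : measurable_fun setT (fun w => \sum_(z <- F) log_bump_at Y n z w).
  by apply: measurable_sum => z; exact: (bdd_mfun_log_bump_at Y n z).1.
have mA' := measurable_fun_abs_gt (harmonic_sum R n / 4) c mW.
apply: (@le_trans _ _ (P ([set w |
    (harmonic_sum R n / 4 < `|\sum_(z <- F) log_bump_at Y n z w - c|)%R] `|` U))).
  apply: le_measure; rewrite ?inE.
  - exact: measurable_fun_abs_gt.
  - exact: measurableU.
  - move=> w /= hw; have [Uw|Uw] := pselect (U w); [by right|left].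
    by rewrite -(UP w Uw).
rewrite EFinD; apply: (le_trans (measureU2 _ _ _)) => //.
by rewrite leeD//; exact: log_bump_concentration.
Qed.

(** The event is that [smoothed_count (n k)] is farther than a quarter of the
    harmonic sum from its centre c k for infinitely many k. Outside it the
    statistic is eventually close to its centre, and adding or removing x moves
    it by more than three quarters of the harmonic sum. *)
Lemma exists_separating_event : exists E : set (set_function R d),
  [/\ measurable E, P (Lambda @^-1` E) = 0%E &
    forall mu, simple_point_measure mu -> ~ E mu ->
    forall x, E (add_point mu x) /\ E (remove_point mu x)].
Proof.
(* each of the two error terms is at most half of 2^-(k+1), a summable bound *)
have nP k : exists n, (k < n)%N /\
    16 * moment_bound Y / harmonic_sum R n <= 1 / (2 ^ k.+2)%:R.
  have V0 : 0 <= moment_bound Y.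
    rewrite /moment_bound mulr_ge0// addr_ge0// /mean Rintegral_ge0// => w _.
    by rewrite exprn_ge0// sqrtr_ge0.
  have [n hn] := harmonic_sum_unbounded (16 * moment_bound Y * (2 ^ k.+2)%:R).
  exists (maxn n k.+1); split; first by rewrite leq_maxr.
  have hm : 16 * moment_bound Y * (2 ^ k.+2)%:R < harmonic_sum R (maxn n k.+1).
    by rewrite (lt_le_trans hn)// le_harmonic_sum// leq_maxl.
  have p2 : 0 < (2 ^ k.+2)%:R :> R by rewrite ltr0n expn_gt0.
  have h0 : 0 < harmonic_sum R (maxn n k.+1).
    apply: le_lt_trans hm; apply: mulr_ge0; last exact: ltW.
    by apply: mulr_ge0.
  rewrite ler_pdivrMr// mul1r [leRHS]mulrC ler_pdivlMr//.
  exact: ltW.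
have [n nP'] := choice nP.
have cP k : exists c,
   (P [set w | (harmonic_sum R (n k) / 4 < `|smoothed_count (n k) (Lambda w) - c|)%R] <=
    (1 / (2 ^ k.+1)%:R)%R%:E)%E.
  have e0 : 0 < 1 / (2 ^ k.+2)%:R :> R by rewrite divr_gt0// ltr0n expn_gt0.
  have n0 : (0 < n k)%N := leq_ltn_trans (leq0n k) (nP' k).1.
  have [c Pc] := smoothed_count_concentration n0 e0.
  exists c; apply: (le_trans Pc); rewrite lee_fin.
  apply: le_trans (lerD (nP' k).2 (lexx _)) _.
  have p0 : (2 ^ k.+1)%:R != 0 :> R by rewrite pnatr_eq0 -lt0n expn_gt0.
  have -> : 1 / (2 ^ k.+2)%:R = 1 / (2 ^ k.+1)%:R / 2 :> R.
    by rewrite [(2 ^ k.+2)%N]expnS natrM; field.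
  lra.
have [c cP'] := choice cP.
pose B k : set (set_function R d) :=
  [set mu | harmonic_sum R (n k) / 4 < `|smoothed_count (n k) mu - c k|].
have mB k : measurable (B k).
  exact: (measurable_fun_abs_gt _ _ (measurable_smoothed_count _)).
exists (lim_sup_set B); split.
- by apply: bigcapT_measurable => k; apply: bigcup_measurable => j _.
- rewrite (_ : _ @^-1` _ = lim_sup_set (fun k => Lambda @^-1` B k)); last first.
    rewrite /lim_sup_set preimage_bigcap.
    by under eq_bigcapr do rewrite preimage_bigcup.
  apply: lim_sup_set_cvg0 => [k|].
    rewrite -[X in measurable X]setTI.
    have mL : measurable_fun setT (Lambda : Omega -> _) by [].
    exact: mL.
  apply: le_lt_trans (ltry 1).
  apply: le_trans (epsilon_trick0 xpredT ler01).
  by apply: lee_nneseries => // k _; exact: cP'.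
- move=> mu smu /existsNP[K /not_implyP[_ Kmu]] x.
  have {}Kmu k : (K <= k)%N ->
      `|smoothed_count (n k) mu - c k| <= harmonic_sum R (n k) / 4.
    by move=> Kk; rewrite leNgt; apply/negP => h; apply: Kmu; exists k.
  have [r xr] := exists_inbox x.
  have [J hJ] := harmonic_sum_unbounded (4 * harmonic_sum R r).
  have bx k : (maxn r J <= k)%N -> 3 / 4 * harmonic_sum R (n k) < log_bump (n k) x.
    rewrite geq_max => /andP[rk Jk].
    have kn := ltnW (nP' k).1.
    apply: lt_le_trans (log_bump_ge (leq_trans rk kn) xr).
    have := @le_harmonic_sum R _ _ (leq_trans Jk kn); lra.
  have hp k : (maxn r J <= k)%N -> 0 < harmonic_sum R (n k).
    rewrite geq_max => /andP[rk Jk].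
    have kn := ltnW (nP' k).1.
    apply: lt_le_trans (@le_harmonic_sum R _ _ (leq_trans Jk kn)).
    apply: le_lt_trans hJ.
    by rewrite mulr_ge0 ?harmonic_sum_ge0.
  (* s = 1 is the insertion of x, s = -1 its deletion *)
  have key k (s : R) : (maxn (maxn r J) K <= k)%N -> `|s| = 1 ->
      harmonic_sum R (n k) / 4 <
      `|smoothed_count (n k) mu + s * log_bump (n k) x - c k|.
    rewrite geq_max => /andP[rJk Kk] s1.
    have := Kmu k Kk; have := bx k rJk; have := hp k rJk.
    have := ler_norm (log_bump (n k) x).
    have := lerB_normD (s * log_bump (n k) x) (smoothed_count (n k) mu - c k).
    rewrite normrM s1 mul1r.
    rewrite (_ : smoothed_count (n k) mu + s * log_bump (n k) x - c k =
      s * log_bump (n k) x + (smoothed_count (n k) mu - c k)); last by ring.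
    lra.
  split => N _ /=; exists (maxn N (maxn (maxn r J) K)) => /=;
    rewrite ?leq_maxl// /B/=.
  - rewrite smoothed_count_add_point// -[log_bump _ _]mul1r; apply: key;
      by rewrite ?leq_maxr ?normr1.
  - rewrite smoothed_count_remove_point// -mulN1r; apply: key;
      by rewrite ?leq_maxr ?normrN1.
Qed.

End singular.

(** * A uniform point of the unit cube *)

Definition unit_cube (R : realType) (d : nat) : set (vec R d) :=
  [set x | forall i, 0 <= tnth x i <= 1].
Arguments unit_cube : clear implicits.

Section unit_cube.
Context {R : realType}.

Lemma measurable_unit_cube d : measurable (unit_cube R d).
Proof.
rewrite (_ : unit_cube R d =
    \bigcap_(i in [set: 'I_d]) ((@tnth _ R ^~ i) @^-1` `[0, 1])).
  apply: fin_bigcap_measurable => [|i _]; first exact: finite_finset.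
  rewrite -[X in measurable X]setTI; exact: measurable_tnth.
apply/seteqP; split => x /=; first by move=> x01 i _; rewrite /= in_itv/= x01.
by move=> x01 i; have := x01 i I; rewrite /= in_itv.
Qed.

Lemma unit_cube_cons d x (t : vec R d) :
  unit_cube R d.+1 (cons_tuple x t) <-> (0 <= x <= 1) /\ unit_cube R d t.
Proof.
split=> [h|[x01 t01] i].
  split=> [|i]; first by have := h ord0; rewrite tnth0.
  by have := h (lift ord0 i); rewrite tnthS.
by have [j ->|->] := unliftP ord0 i; rewrite ?tnth0 ?tnthS.
Qed.

(** Induction along the iterated integral that defines [lebesgue_vec]: a uniform
    first coordinate is prepended to an independent point of the cube of lower
    dimension. *)
Lemma unit_cube_law d : exists nu : probability (vec R d) R,
  forall A, measurable A -> nu A = lebesgue_vec (A `&` unit_cube R d).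
Proof.
elim: d => [|d [nu nuE]].
  exists (dirac ([tuple] : vec R 0)) => A mA /=.
  rewrite /dirac/= !indicE; congr (_%:R%:E); congr (nat_of_bool _).
  by apply/idP/idP; rewrite !inE => //; [move=> ?; split=> // -[]|case].
pose U := @uniform_prob R 0 1 ltr01.
(* measurableTypeR R carries the sigma-algebra of R under another display *)
pose c (xt : measurableTypeR R * vec R d) : vec R d.+1 := cons_tuple xt.1 xt.2.
have mid : measurable_fun setT (fun x : measurableTypeR R => x : R) by [].
have mc : measurable_fun setT c.
  apply: measurable_cons; first exact: (measurableT_comp mid measurable_fst).
  exact: measurable_snd.
pose C : {RV (U \x nu)%E >-> vec R d.+1} := mfun_Sub (mem_set mc).
exists (distribution (U \x nu)%E C) => A mA.
have mCA : measurable (c @^-1` A).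
  by rewrite -[X in measurable X]setTI; exact: (mc measurableT _ mA).
rewrite /distribution/= /pushforward.
rewrite [LHS](_ : _ = (\int[U]_x (nu \o xsection (c @^-1` A)) x)%E)//.
rewrite integral_uniform//; last exact: measurable_fun_xsection.
rewrite subr0 invr1 mul1e integral_mkcond; apply: eq_integral => x _.
rewrite patchE mem_setE in_itv/=; case: ifPn => x01.
  rewrite /= nuE; last exact: measurable_xsection.
  congr lebesgue_vec; apply/seteqP; split => t /=.
    by move=> [/xsectionP ct t01]; split=> //; apply/unit_cube_cons.
  by move=> [ct /unit_cube_cons[_ t01]]; split=> //; apply/xsectionP.
rewrite (_ : [set t | _] = set0 `&` unit_cube R d).
  by rewrite -nuE// measure0.
rewrite set0I; apply/seteqP; split => t //= -[_ /unit_cube_cons[]].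
by rewrite (negbTE x01).
Qed.

Lemma lebesgue_unit_cube d : lebesgue_vec (unit_cube R d) = 1%E.
Proof.
have [nu nuE] := unit_cube_law d.
by rewrite -[X in lebesgue_vec X]setTI -nuE//; exact: (probability_setT nu).
Qed.

End unit_cube.

(** The two projections of the product of P with the uniform law of the
    cube. *)
Lemma independent_copy_with_uniform_point (R : realType) (d : nat)
    (disp : measure_display) (Omega : measurableType disp)
    (P : probability Omega R) (Lambda : {RV P >-> set_function R d}) :
  point_process Lambda ->
  exists (disp' : measure_display)
    (Omega' : measurableType disp') (P' : probability Omega' R)
    (Pi' : {RV P' >-> set_function R d}) (U : {RV P' >-> vec R d}),
  [/\ point_process Pi', same_law P' P Pi' Lambda,
      uniform_on P' (unit_cube R d) U & independent P' U Pi'].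
Proof.
move=> Lambda_pp; have [nu nuE] := @unit_cube_law R d.
have mL : measurable_fun setT (Lambda \o (fst : Omega * vec R d -> Omega)).
  exact: measurableT_comp.
have mU : measurable_fun setT (snd : Omega * vec R d -> vec R d) by [].
have lawL E : measurable E ->
    (P \x nu)%E ((Lambda \o fst) @^-1` E) = P (Lambda @^-1` E).
  move=> mE; have mLE : measurable (Lambda @^-1` E) by exact: measurable_funPTI.
  have -> : (Lambda \o fst) @^-1` E = (Lambda @^-1` E) `*` [set: vec R d].
    by apply/seteqP; split => w /=; [|case].
  transitivity (P (Lambda @^-1` E) * nu setT)%E; first exact: product_measure1E.
  by rewrite [X in (_ * X)%E](_ : _ = 1%E) ?mule1//; exact: (probability_setT nu).
have lawU A : measurable A -> (P \x nu)%E (snd @^-1` A) = nu A.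
  move=> mA; have -> : snd @^-1` A = [set: Omega] `*` A.
    by apply/seteqP; split => w /=; [|case].
  transitivity (P setT * nu A)%E; first exact: product_measure1E.
  by rewrite [X in (X * _)%E](_ : _ = 1%E) ?mul1e//; exact: (probability_setT P).
exists _, (Omega * vec R d)%type, (P \x nu)%E, (mfun_Sub (mem_set mL)),
  (mfun_Sub (mem_set mU)); split.
- by move=> w; exact: Lambda_pp.
- by move=> E mE; exact: lawL.
- by move=> A mA; rewrite lebesgue_unit_cube invr1 mul1e -nuE//; exact: lawU.
- move=> A E mA mE.
  have mLE : measurable (Lambda @^-1` E) by exact: measurable_funPTI.
  have -> : (snd @^-1` A) `&` ((Lambda \o fst) @^-1` E) = (Lambda @^-1` E) `*` A.
    by apply/seteqP; split => w /= [].
  transitivity (P (Lambda @^-1` E) * nu A)%E; first exact: product_measure1E.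
  by rewrite muleC; congr (_ * _)%E; apply/esym; [exact: lawU|exact: lawL].
Qed.

(** The complement of E has full measure for X and is mapped into E. *)
Lemma not_prec_of_null_event (R : realType) (disp1 disp2 disp3 : measure_display)
    (Omega1 : measurableType disp1) (Omega2 : measurableType disp2)
    (T : measurableType disp3) (P1 : probability Omega1 R)
    (P2 : probability Omega2 R) (X X' : Omega1 -> T) (Y : Omega2 -> T)
    (E : set T) : measurable E -> measurable_fun setT X -> measurable_fun setT X' ->
  same_law P1 P2 X Y -> P2 (Y @^-1` E) = 0%E ->
  (forall w, ~ E (X w) -> E (X' w)) -> ~ prec P1 P2 X' Y.
Proof.
move=> mE mX mX' XY YE XX' /(_ E mE YE) X'E.
have mXE : measurable (X @^-1` E).
  by rewrite -[X in measurable X]setTI; exact: mX.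
have mXE' : measurable (X' @^-1` E).
  by rewrite -[X in measurable X]setTI; exact: mX'.
have : (P1 setT <= P1 ((X @^-1` E) `|` (X' @^-1` E)))%E.
  apply: le_measure; rewrite ?inE//; first exact: measurableU.
  move=> w _; have [Ew|Ew] := pselect (E (X w)); first by left.
  by right; exact: XX'.
rewrite [X in (X <= _)%E](_ : _ = 1%E); last exact: (probability_setT P1).
apply/negP; rewrite -ltNge [X in (X < _)%E](_ : _ = 0%E) ?lte01//.
transitivity (P1 (X @^-1` E)); first exact: measureU0.
by rewrite -YE; exact: XY.
Qed.

Unset Implicit Arguments.
Set Strict Implicit.

(* The almost sure injectivity hypothesis is the standing assumption that the
   point process \sum_z \d_(z + Y_z) is simple. *)
Theorem proposition11 (R : realType) (d : nat) (hd : d = 1%N \/ d = 2%N)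
    (disp : measure_display) (Omega : measurableType disp)
    (P : probability Omega R)
    (Y : d.-tuple int -> {RV P >-> vec R d})
    (Y_iid : iid P (fun z => Y z : Omega -> vec R d))
    (Lambda : {RV P >-> set_function R d})
    (Lambda_pp : point_process Lambda)
    (Lambda_supp : {ae P, forall w, point_support (Lambda w) =
       range (fun z : d.-tuple int => lattice_translate z (Y z w))})
    (Lambda_simple : {ae P, forall w,
       injective (fun z : d.-tuple int => lattice_translate z (Y z w))})
    (Y_moment : ('E_P[(fun w => enorm (Y (origin d) w) ^+ d)%R] < +oo)%E) :
  ~ insertion_tolerant Lambda /\ ~ deletion_tolerant Lambda.
Proof.
have [E [mE LE0 EP]] :=
  exists_separating_event Y_iid hd Y_moment Lambda_pp Lambda_supp Lambda_simple.
split.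
- have [dispX [OmegaX [PX [PiX [U [PiX_pp PiXL unifU indep]]]]]] :=
    independent_copy_with_uniform_point Lambda_pp.
  move=> /(_ (unit_cube R d) (@measurable_unit_cube R d)).
  rewrite lebesgue_unit_cube lte01 ltry.
  move=> /(_ isT isT _ _ _ _ _ PiX_pp PiXL unifU indep).
  apply: (not_prec_of_null_event mE _ _ PiXL LE0) => //.
    exact: measurable_add_point.
  by move=> w Ew; have [] := EP _ (PiX_pp w) Ew (U w).
- move=> /(_ (Y (origin d))) del.
  have : prec P P (fun w => remove_point (Lambda w) (Y (origin d) w)) Lambda.
    apply: del; apply: filterS Lambda_supp => w ->.
    exists (origin d) => //; apply: eq_from_tnth => i.
    by rewrite !tnth_mktuple add0r.
  apply: (not_prec_of_null_event mE (X := Lambda) _ _ _ LE0) => //.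
    exact: measurable_remove_point.
  by move=> w Ew; have [] := EP _ (Lambda_pp w) Ew (Y (origin d) w).
Qed.
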